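(* Let $(L_n)_{n\ge 0}$ be the Lucas sequence and $\Phi=\frac{1+\sqrt5}{2}$. For a natural number $n$, a non-consecutive partition of $n$ is a finite set $I\subseteq\{0,1,2,\ldots\}$ with no two elements consecutive integers and $\sum_{i\in I}L_i=n$ (with $L_0$ and $L_2$ allowed to appear simultaneously). Let $c(N)$ be the number of natural numbers $n\le N$ having more than one non-consecutive partition. Then $$\lim_{N\to\infty}\frac{c(N)}{N}=\frac{1}{3\Phi+1}.$$
   Context: The Lucas sequence is defined by $L_0=2$, $L_1=1$, and $L_n=L_{n-1}+L_{n-2}$ for $n\ge 2$. *)

(* Defs.v *)
From mathcomp Require Import all_boot all_order all_algebra finmap.
From mathcomp Require Import boolp reals.

Set Implicit Arguments.
Unset Strict Implicit.
Unset Printing Implicit Defensive.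

Import Order.TTheory GRing.Theory Num.Theory.

Local Open Scope fset_scope.

Fixpoint lucas (n : nat) : nat :=
  match n with
  | 0 => 2
  | 1 => 1
  | (m.+1 as p).+1 => lucas p + lucas m
  end.

Definition nonconsecutive (I : {fset nat}) : Prop :=
  forall i : nat, i \in I -> i.+1 \notin I.

(* Indices 0 and 2 may both occur in I: only adjacent indices are excluded. *)
Definition nonconsecutive_partition (n : nat) (I : {fset nat}) : Prop :=
  nonconsecutive I /\ (\sum_(i <- I) lucas i)%N = n.

Definition has_multiple_partitions (n : nat) : Prop :=
  exists I J : {fset nat},
    [/\ I <> J, nonconsecutive_partition n I & nonconsecutive_partition n J].

Definition multiple_count (N : nat) : nat :=
  #|[pred n : 'I_N.+1 | `[< has_multiple_partitions n >]]|.

Local Open Scope ring_scope.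

Definition golden_ratio (R : realType) : R := (1 + Num.sqrt 5) / 2.

(* Main.v *)
(* Partitions not using both 0 and 2 are unique, as in Zeckendorf's theorem, so
   n has several partitions iff n - 5 is a sum of non-consecutive Lucas numbers
   of index at least 4.  The counting function A of these sums satisfies
   A(L_k + m) = A(L_k) + A(m) for m <= L_(k-1).  For delta = 1 / (3 Phi + 1), the
   error A(N) - delta N at N = L_k is a multiple of (1 - Phi)^k, so the errors
   of the terms in the greedy expansion of N sum geometrically: A(N) - delta N
   is bounded. *)
Require Import Defs.
From mathcomp Require Import all_boot all_order all_algebra.
From mathcomp Require Import finmap zify ring lra.
From mathcomp Require Import boolp classical_sets reals topology normedtype sequences.

Import Order.TTheory GRing.Theory Num.Theory numFieldNormedType.Exports.

Local Open Scope fset_scope.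
Local Open Scope nat_scope.

(** * Lucas numbers and their sums over finite index sets *)

Lemma lucasSS n : lucas n.+2 = lucas n.+1 + lucas n.
Proof. by []. Qed.

Lemma lucas_gt0 n : 0 < lucas n.
Proof.
suff: (0 < lucas n) && (0 < lucas n.+1) by case/andP.
by elim: n => // n /andP[h1 h2]; rewrite h2 lucasSS addn_gt0 h2.
Qed.

(** Monotonicity only starts at index 1, because $L_0 = 2 > L_1 = 1$. *)
Lemma leq_lucas m n : 0 < m -> m <= n -> lucas m <= lucas n.
Proof.
move=> m_gt0 /subnK <-; elim: (n - m) => [//|d IHd].
apply: leq_trans IHd _; rewrite addSn.
have: 0 < d + m by lia.
by case: (d + m) => // p _; rewrite lucasSS leq_addr.
Qed.

Definition lucas_sum (I : {fset nat}) : nat := \sum_(i <- I) lucas i.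

Lemma lucas_sumD1 x (I : {fset nat}) :
  lucas_sum I = (x \in I) * lucas x + lucas_sum (I `\ x).
Proof.
case: (boolP (x \in I)) => xI; first by rewrite /lucas_sum (big_fsetD1 x) //= mul1n.
by rewrite mul0n mem_fsetD1.
Qed.

Lemma lucas_sumU1 x (I : {fset nat}) :
  x \notin I -> lucas_sum (x |` I) = lucas x + lucas_sum I.
Proof. by move=> xI; rewrite /lucas_sum big_fsetU1. Qed.

Lemma leq_lucas_sum i (I : {fset nat}) : i \in I -> lucas i <= lucas_sum I.
Proof. by move=> iI; rewrite (lucas_sumD1 i) iI mul1n leq_addr. Qed.

Lemma lucas_sum0 : lucas_sum fset0 = 0.
Proof. by rewrite /lucas_sum big_seq_fset0. Qed.

Definition bounded_by (k : nat) (I : {fset nat}) := forall i, i \in I -> i < k.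

Lemma bounded_by0 I : bounded_by 0 I -> I = fset0.
Proof. by move=> bI; apply/eqP/fset0Pn => -[i /bI]. Qed.

Lemma bounded_byD1 k I : bounded_by k.+1 I -> bounded_by k (I `\ k).
Proof. by move=> bI i; rewrite !inE => /andP[ik /bI]; lia. Qed.

Lemma bounded_by_notin k I : bounded_by k.+1 I -> k \notin I -> bounded_by k I.
Proof. by move=> bI kI; rewrite -(mem_fsetD1 kI); apply: bounded_byD1. Qed.

Lemma nonconsecutiveD1 x I : nonconsecutive I -> nonconsecutive (I `\ x).
Proof.
by move=> nI i; rewrite !inE => /andP[_ /nI h]; rewrite (negbTE h) andbF.
Qed.

Lemma nonconsecutiveU1 k I : nonconsecutive I -> bounded_by k I ->
  nonconsecutive (k.+1 |` I).
Proof.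
move=> nI bI i; rewrite !inE => /predU1P[->|iI].
  by apply/norP; split; [lia | apply/negP => /bI; lia].
by have := bI i iI; have := nI i iI; move=> h ?; rewrite negb_or h andbT; lia.
Qed.

(** The top index [k.+1] excludes its neighbour [k], so the bound drops by two, in step with the
    Lucas recurrence. *)
Lemma nonconsecutive_boundedD1 k I : nonconsecutive I -> bounded_by k.+2 I ->
  k.+1 \in I -> bounded_by k (I `\ k.+1).
Proof.
move=> nI bI kI; apply: bounded_by_notin; first exact: bounded_byD1.
by rewrite !inE negb_and; apply/orP; right; apply/negP => /nI; rewrite kI.
Qed.

(** * Canonical partitions and the numbers with several partitions *)

(** The second condition restores uniqueness: $L_0 + L_2 = 5 = L_1 + L_3$. *)
Definition canonical (I : {fset nat}) :=
  nonconsecutive I /\ ~~ ((0 \in I) && (2 \in I)).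

Lemma canonicalD1 x I : canonical I -> canonical (I `\ x).
Proof.
move=> [nI h]; split; first exact: nonconsecutiveD1.
by apply: contra h; rewrite !inE => /andP[/andP[_ ->] /andP[_ ->]].
Qed.

Lemma lucas_sum_bounded2 I : bounded_by 2 I ->
  lucas_sum I = (0 \in I) * 2 + (1 \in I).
Proof.
move=> bI; rewrite (lucas_sumD1 1) (lucas_sumD1 0).
rewrite (bounded_by0 (I `\ 1 `\ 0)); last by do 2![apply: bounded_byD1].
by rewrite lucas_sum0 !inE /=; lia.
Qed.

(* At k = 1 this fails for I = {0}, as L_0 = 2 > L_1. *)
Lemma lucas_sum_lt k I : k != 1 -> canonical I -> bounded_by k I ->
  lucas_sum I < lucas k.
Proof.
elim/ltn_ind: k I => -[_ I _ _ /bounded_by0 ->|[//|[|k]] IH I _ cI bI].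
- by rewrite lucas_sum0.
- rewrite lucas_sum_bounded2 //= ; case: cI => nI _.
  by have := nI 0; case: (0 \in I); case: (1 \in I) => // /(_ isT).
- case: (boolP (k.+2 \in I)) => kI; last first.
    apply: (@leq_trans (lucas k.+2)); last exact: leq_lucas.
    by apply: IH => //; apply: bounded_by_notin.
  rewrite (lucas_sumD1 k.+2) kI mul1n (lucasSS k.+1) ltn_add2l.
  have bI' := nonconsecutive_boundedD1 _ _ (proj1 cI) bI kI.
  case: k => [|k] in IH bI kI bI' *; last by apply: IH => //; apply: canonicalD1.
  rewrite (bounded_by0 (I `\ 2)) ?lucas_sum0 //.
  apply: bounded_by_notin bI' _; case: cI => _; rewrite kI andbT !inE.
  by apply: contra.
Qed.

(** Without [k] the sum stays below [lucas k] by [lucas_sum_lt]. Hence the sum alone decides whether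
    the top index occurs, which drives uniqueness. *)
Lemma canonical_top k I : 1 < k -> canonical I -> bounded_by k.+1 I ->
  (k \in I) = (lucas k <= lucas_sum I).
Proof.
move=> k_gt1 cI bI; case: (boolP (k \in I)) => kI; first by rewrite leq_lucas_sum.
apply/esym/negbTE; rewrite -ltnNge; apply: lucas_sum_lt => //; first by lia.
exact: bounded_by_notin.
Qed.

(** The top index is read off the common sum and stripped from both sets. In the base case the
    admissible subsets of $\{0, 1\}$ have the distinct sums 0, 1, 2. *)
Lemma canonical_inj_bounded k I J : canonical I -> canonical J ->
  bounded_by k.+2 I -> bounded_by k.+2 J -> lucas_sum I = lucas_sum J -> I = J.
Proof.
elim: k I J => [|k IH] I J cI cJ bI bJ eIJ.
  have [nI nJ] := (proj1 cI 0, proj1 cJ 0).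
  move: eIJ; rewrite !lucas_sum_bounded2 // => eIJ.
  apply/fsetP => -[|[|i]].
  - by move: nI nJ eIJ; case: (0 \in I); case: (0 \in J); case: (1 \in I);
      case: (1 \in J) => // h h'; lia.
  - by move: nI nJ eIJ; case: (0 \in I); case: (0 \in J); case: (1 \in I);
      case: (1 \in J) => // h h'; lia.
  - by apply/idP/idP => [/bI|/bJ].
have tIJ : (k.+2 \in I) = (k.+2 \in J) by rewrite !canonical_top // eIJ.
have eD : I `\ k.+2 = J `\ k.+2.
  apply: IH; try exact: canonicalD1; try exact: bounded_byD1.
  by move: eIJ; rewrite (lucas_sumD1 k.+2 I) (lucas_sumD1 k.+2 J) tIJ => /addnI.
apply/fsetP => i; have [->//|ik] := eqVneq i k.+2.
by move/fsetP/(_ i): eD; rewrite !inE ik.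
Qed.

Lemma bounded_by_exists I : exists k, bounded_by k I.
Proof.
exists (\max_(i <- I) i).+1 => i iI.
by rewrite ltnS; apply: (leq_bigmax_seq (F := id)).
Qed.

Lemma canonical_inj I J : canonical I -> canonical J ->
  lucas_sum I = lucas_sum J -> I = J.
Proof.
have [[k bI] [l bJ]] := (bounded_by_exists I, bounded_by_exists J).
move=> cI cJ; apply: (@canonical_inj_bounded (k + l)) => // i => [/bI|/bJ]; lia.
Qed.

Lemma nonconsecutive1 x : nonconsecutive [fset x].
Proof. by move=> i; rewrite !inE => /eqP ->; lia. Qed.

Lemma lucas_sum1 x : lucas_sum [fset x] = lucas x.
Proof. by rewrite /lucas_sum big_seq_fset1. Qed.

(** Greedy choice: if $L_{k-1} \le n$, the remainder is below $L_{k-2}$ and so uses only indices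
    below $k-2$. *)
Lemma canonical_exists_bounded k n : 1 < k -> n < lucas k ->
  exists I, [/\ canonical I, bounded_by k I & lucas_sum I = n].
Proof.
have c0 : canonical fset0 by split=> // i.
have c1 x : canonical [fset x].
  by split; [exact: nonconsecutive1 | rewrite !inE; case: x].
have b1 x l : x < l -> bounded_by l [fset x].
  by move=> xl i; rewrite !inE => /eqP ->.
elim/ltn_ind: k n => k IH n k1 nk.
(* For [k >= 4] the adjoined index is at least 3, hence neither 0 nor 2, and the bound on the
   remainder is still at least 2. Otherwise [n < 4], and 1, 2, 3 are $L_1$, $L_0$, $L_2$. *)
have [k_lt4|k_ge4] := ltnP k 4; last first.
  case: k => [//|[//|k]] in IH k1 nk k_ge4 *.
  have [h|h] := ltnP n (lucas k.+1).
    have [|||I [cI bI eI]] := IH k.+1 _ n => //; first by lia.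
    by exists I; split => // i /bI; lia.
  have [|||I [cI bI eI]] := IH k _ (n - lucas k.+1) => //; try by lia.
    by move: nk; rewrite lucasSS; lia.
  have kI : k.+1 \notin I by apply/negP => /bI; lia.
  exists (k.+1 |` I); split; last by rewrite lucas_sumU1 // eI; lia.
    split; first by apply: nonconsecutiveU1 => //; case: cI.
    by case: cI => _; rewrite !inE; case: k k_ge4 {IH k1 nk h bI eI kI} => [//|[]].
  by move=> i; rewrite !inE => /predU1P[->//|/bI]; lia.
have [->|n0] := eqVneq n 0.
  by exists fset0; split => //; rewrite lucas_sum0.
have [->|n1] := eqVneq n 1.
  by exists [fset 1]; split; rewrite ?lucas_sum1 //; apply: b1.
have [->|n2] := eqVneq n 2.
  by exists [fset 0]; split; rewrite ?lucas_sum1 //; apply: b1; lia.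
exists [fset 2]; move: k k_lt4 k1 nk {IH} => [|[|[|[|]]]] //= _ _ nk; try lia.
by split; rewrite ?lucas_sum1 //=; [apply: b1 | lia].
Qed.

Lemma ltn_lucas n : n < lucas n.+2.
Proof.
elim: n => // n IH; rewrite lucasSS.
by have := lucas_gt0 n.+1; lia.
Qed.

Lemma canonical_exists n : exists2 I, canonical I & lucas_sum I = n.
Proof.
have [//|I [cI _ eI]] := canonical_exists_bounded n.+2 n _ (ltn_lucas n).
by exists I.
Qed.

(* A partition using both 0 and 2 avoids 1 and 3, so it is 0 and 2 adjoined to
   such a set J. *)
Definition tail_sum (s : nat) : Prop := exists J : {fset nat},
  [/\ nonconsecutive J, forall i, i \in J -> 3 < i & lucas_sum J = s].

(** Two distinct partitions cannot both be canonical, so one contains 0 and 2, which contribute 5.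
    Conversely, adjoining 0 and 2 to a tail gives a partition different from the canonical one. *)
Lemma has_multiple_partitionsE n :
  has_multiple_partitions n <-> 5 <= n /\ tail_sum (n - 5).
Proof.
split.
  move=> [I [J [neIJ [nI eI] [nJ eJ]]]].
  have main K : nonconsecutive K -> lucas_sum K = n -> (0 \in K) && (2 \in K) ->
      5 <= n /\ tail_sum (n - 5).
    move=> nK eK /andP[K0 K2].
    have eK' : n = 5 + lucas_sum (K `\ 0 `\ 2).
      by rewrite -eK (lucas_sumD1 0) K0 (lucas_sumD1 2) !inE K2 /=; lia.
    split; first by rewrite eK' leq_addr.
    exists (K `\ 0 `\ 2); split; last by rewrite eK' addKn.
      by do 2![apply: nonconsecutiveD1].
    move=> [|[|[|[|i]]]]; rewrite !inE //=; first by move/negP: (nK _ K0).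
    by move/negP: (nK _ K2).
  case: (boolP ((0 \in I) && (2 \in I))) => cI; first exact: main cI.
  case: (boolP ((0 \in J) && (2 \in J))) => cJ; first exact: main cJ.
  by case: neIJ; apply: canonical_inj; [split..|rewrite /lucas_sum eI eJ].
move=> [n5 [J [nJ J4 eJ]]].
have J0 : 0 \notin 2 |` J by rewrite !inE; apply/negP => /J4.
have J2 : 2 \notin J by apply/negP => /J4.
have [I [nI cI] eI] := canonical_exists n.
exists I, (0 |` (2 |` J)); split.
- by move=> e; move/negP: cI; apply; rewrite e !inE.
- by split.
- split; last by rewrite -/(lucas_sum _) !lucas_sumU1 // eJ /=; lia.
  move=> i; rewrite !inE => /or3P[/eqP->|/eqP->|iJ].
  + by apply/negP => /J4.
  + by apply/negP => /J4.
  + by rewrite !negb_or (nJ _ iJ); have := J4 _ iJ; lia.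
Qed.

(** * Tail sums and how many lie below a bound *)

(** The least available summand is $L_4 = 7$. *)
Lemma tail_sum_lt7 s : s < 7 -> tail_sum s <-> s = 0.
Proof.
move=> s7; split=> [[J [nJ J4 eJ]]|->]; last by exists fset0; rewrite lucas_sum0.
case: (fset_0Vmem J) => [J0|[i iJ]]; first by rewrite -eJ J0 lucas_sum0.
have := leq_lucas_sum _ _ iJ; have := @leq_lucas 4 i isT (J4 _ iJ).
by rewrite eJ [lucas 4]/=; lia.
Qed.

(** Since $L_k + s < L_{k+1}$, a set with this sum has top index exactly [k], which can be removed.
    Conversely, $s < L_{k-1}$ keeps all indices below $k-1$, so [k] can be adjoined. *)
Lemma tail_sum_addl k s : 3 < k -> s < lucas k.-1 ->
  tail_sum (lucas k + s) <-> tail_sum s.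
Proof.
case: k => [//|k]; rewrite [k.+1.-1]/= => k3 sk; split=> -[J [nJ J4 eJ]].
  have bJ : bounded_by k.+2 J.
    move=> i iJ; rewrite ltnNge; apply/negP => /(@leq_lucas k.+2 i isT).
    by have := leq_lucas_sum _ _ iJ; rewrite eJ lucasSS; lia.
  have cJ : canonical J by split => //; apply/negP => /andP[/J4].
  have kJ : k.+1 \in J by rewrite canonical_top ?eJ ?leq_addr //; lia.
  exists (J `\ k.+1); split; first exact: nonconsecutiveD1.
    by move=> i; rewrite !inE => /andP[_ /J4].
  by move: eJ; rewrite (lucas_sumD1 k.+1) kJ mul1n => /addnI.
have bJ : bounded_by k J.
  move=> i iJ; rewrite ltnNge; apply/negP => /leq_lucas h.
  have := leq_lucas_sum _ _ iJ; rewrite eJ; have := h ltac:(lia); lia.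
exists (k.+1 |` J); split; first exact: nonconsecutiveU1.
  by move=> i; rewrite !inE => /predU1P[->|/J4].
by rewrite lucas_sumU1 ?eJ //; apply/negP => /bJ; lia.
Qed.

Definition tail_count (N : nat) : nat := \sum_(0 <= s < N) `[< tail_sum s >].

(** With $n = s + 5$, the condition $n \le N$ reads $s < N - 4$. For [N < 4] the truncated
    difference is 0, as is the count. *)
Lemma multiple_countE N : multiple_count N = tail_count (N - 4).
Proof.
rewrite /multiple_count -sum1_card.
rewrite (eq_bigl (fun n : 'I_N.+1 => `[< has_multiple_partitions n >])) //.
rewrite big_mkcond -(big_mkord xpredT (fun n => if `[< has_multiple_partitions n >] then 1 else 0)) /=.
have small m : m <= 5 ->
    \sum_(0 <= n < m) (if `[< has_multiple_partitions n >] then 1 else 0) = 0.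
  move=> m5; rewrite big_nat_cond big1 // => n /andP[/andP[_ nm] _].
  by case: ifP => // /asboolP/has_multiple_partitionsE[]; lia.
have [N4|N4] := ltnP N 4.
  have -> : N - 4 = 0 by lia.
  by rewrite (small N.+1); [rewrite /tail_count big_geq | lia].
rewrite (@big_cat_nat _ _ _ 5) //= (small 5) // add0n /tail_count.
rewrite -{1}[5]add0n big_addn subSS; apply: eq_bigr => n _.
have -> : `[< has_multiple_partitions (n + 5) >] = `[< tail_sum n >].
  apply: asbool_equiv_eq; rewrite has_multiple_partitionsE addnK.
  by split=> [[]|] // ?; split=> //; lia.
by case: `[< _ >].
Qed.

(** Translation by $L_k$ preserves tail sums below $L_{k-1}$. The range is half-open, so
    [m = lucas k.-1] is allowed, and the recurrence along Lucas numbers needs that case. *)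
Lemma tail_count_add k m : 3 < k -> m <= lucas k.-1 ->
  tail_count (lucas k + m) = tail_count (lucas k) + tail_count m.
Proof.
move=> k3 mk; rewrite /tail_count (@big_cat_nat _ _ _ (lucas k)) ?leq_addr //=.
congr (_ + _); rewrite -{1}[lucas k]add0n big_addn addKn.
rewrite !big_nat; apply: eq_bigr => s /andP[_ sm]; congr nat_of_bool.
by apply: asbool_equiv_eq; rewrite addnC; apply: tail_sum_addl => //; lia.
Qed.

Lemma tail_count_le7 N : N <= 7 -> tail_count N = (0 < N).
Proof.
elim: N => [|N IH] N7; first by rewrite /tail_count big_geq.
rewrite /tail_count big_nat_recr //= -/(tail_count N) IH; last exact: ltnW.
rewrite (asbool_equiv_eq (tail_sum_lt7 N N7)).
by case: (asboolP (N = 0)); lia.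
Qed.

(** * Bounded discrepancy and the limit *)

Local Open Scope classical_set_scope.
Local Open Scope ring_scope.

Section Discrepancy.
Context {R : realType}.
Local Notation Phi := (golden_ratio R).
Local Notation delta := (1 / (3 * Phi + 1)).

Lemma golden_ratio_sq : Phi ^+ 2 = Phi + 1.
Proof.
have h : Num.sqrt (5 : R) ^+ 2 = 5 by rewrite sqr_sqrtr.
by rewrite /golden_ratio; field: h.
Qed.

Lemma golden_ratio_bounds : 1 < Phi < 2.
Proof.
have h : Num.sqrt (5 : R) ^+ 2 = 5 by rewrite sqr_sqrtr.
have h0 : 0 <= Num.sqrt (5 : R) by rewrite sqrtr_ge0.
by rewrite /golden_ratio; apply/andP; split; nra.
Qed.

(** These bounds give $0 < 1 - 4\delta < 1$ and keep $1 - \delta N$ in $[-1, 1]$ for $1 \le N \le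
    7$. *)
Lemma density_bounds : 1 / 7 < delta < 1 / 4.
Proof.
have /andP[h1 h2] := golden_ratio_bounds.
have h4 : 0 < 3 * Phi + 1 by lra.
by apply/andP; split; [rewrite ltr_pdivlMr | rewrite ltr_pdivrMr] => //; lra.
Qed.

Definition discrepancy (N : nat) : R := (tail_count N)%:R - delta * N%:R.

Lemma discrepancyD k m : (3 < k)%N -> (m <= lucas k.-1)%N ->
  discrepancy (lucas k + m) = discrepancy (lucas k) + discrepancy m.
Proof.
by move=> k3 mk; rewrite /discrepancy tail_count_add // !natrD; ring.
Qed.

(* [1 - Phi] is the conjugate root of x^2 = x + 1; the limit [delta] is the
   only value for which the component along the root [Phi] vanishes. *)
Lemma discrepancy_lucas k :
  discrepancy (lucas k.+3) = (1 - Phi) ^+ k * (1 - 4 * delta).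
Proof.
have hP := golden_ratio_sq; have /andP[P1 P2] := golden_ratio_bounds.
have nz : 3 * Phi + 1 != 0 by apply: lt0r_neq0; lra.
suff [] : discrepancy (lucas k.+3) = (1 - Phi) ^+ k * (1 - 4 * delta) /\
  discrepancy (lucas k.+4) = (1 - Phi) ^+ k.+1 * (1 - 4 * delta) by [].
elim: k => [|k [IH1 IH2]].
  rewrite /discrepancy !tail_count_le7 //=; split; first by rewrite expr0; ring.
  (* The value of [delta] enters here, at $L_4 = 7$, through $1 - 7\delta = (1 - \Phi)(1 -
     4\delta)$. *)
  rewrite expr1; apply: (mulIf nz); rewrite !mulrBl !mulrBr.
  field: hP => //.
split=> //; rewrite (lucasSS k.+3) discrepancyD // IH1 IH2 !exprS.
ring: hP.
Qed.

Lemma discrepancy_bound N : `|discrepancy N| <= 2.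
Proof.
have hP := golden_ratio_sq; have /andP[P1 P2] := golden_ratio_bounds.
have /andP[d1 d2] := density_bounds.
have r_pos k : 0 <= (Phi - 1) ^+ k by apply: exprn_ge0; lra.
(* The strengthened bound absorbs a geometric sum. For $r = \Phi - 1$ one has $r^2 = 1 - r$, so
   adding a greedy term of size at most $r^{k+1}$ to the bound $2 - r^k$ gives exactly $2 -
   r^{k+2}$. *)
suff h k : (N <= lucas k.+3)%N -> `|discrepancy N| <= 2 - (Phi - 1) ^+ k.
  apply: le_trans (h N _) _; last by have := r_pos N; lra.
  apply: leq_trans (ltnW (ltn_lucas N)) _; exact: leq_lucas.
elim/ltn_ind: k N => k IH N Nk.
(* As $L_4 = 7$, this case covers [k = 0] and [k = 1]. The discrepancy is at most 1 in absolute
   value here, and $2 - (\Phi - 1)^k \ge 1$. *)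
have [N7|N7] := leqP N 7.
  apply: (@le_trans _ _ 1); last first.
    by have : (Phi - 1) ^+ k <= 1 by [apply: exprn_ile1; lra]; lra.
  rewrite /discrepancy tail_count_le7 // ler_norml.
  have : (N%:R : R) <= 7 by rewrite (ler_nat _ N 7).
  case: N {Nk N7 IH} => [|N] N7; first by rewrite /= mulr0n mulr0 subrr lerN10 ler01.
  have N0 : 0 <= N.+1%:R :> R by [].
  by rewrite /=; apply/andP; split; nra.
case: k => [|[|k]] in IH Nk *; try by move: Nk N7; rewrite /=; lia.
have [h|h] := leqP N (lucas k.+4).
  apply: le_trans (IH k.+1 (ltnSn _) _ h) _.
  have := r_pos k.+1; rewrite (exprS _ k.+1); nra.
have -> : N = (lucas k.+4 + (N - lucas k.+4))%N by lia.
have h' : (N - lucas k.+4 <= lucas k.+3)%N by move: Nk; rewrite lucasSS; lia.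
rewrite discrepancyD // discrepancy_lucas.
apply: le_trans (ler_normD _ _) _.
have := IH k (ltnW (ltnSn _)) _ h'.
have : `|(1 - Phi) ^+ k.+1 * (1 - 4 * delta)| <= (Phi - 1) ^+ k.+1.
  rewrite normrM normrX distrC (ger0_norm (x := Phi - 1)); last by lra.
  by rewrite ler_piMr // ler_norml; apply/andP; split; lra.
have e : (Phi - 1) ^+ k.+2 = (Phi - 1) ^+ k - (Phi - 1) ^+ k.+1.
  rewrite !exprS; ring: hP.
by rewrite e; lra.
Qed.

End Discrepancy.

Theorem theorem1p5 (R : realType) :
  (fun N : nat => (multiple_count N)%:R / N%:R : R) @ \oo -->
    1 / (3 * golden_ratio R + 1).
Proof.
have /andP[d1 d2] := @density_bounds R.
set delta := (X in _ --> X); rewrite -/delta in d1 d2.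
(* The constant 3 is the discrepancy bound 2 plus 1 for the shift by 4, since $4\delta < 1$. *)
have bound N : `|(multiple_count N)%:R - delta * N%:R| <= 3 :> R.
  rewrite multiple_countE.
  have := @discrepancy_bound R (N - 4); rewrite /discrepancy -/delta !ler_norml.
  have [N4|N4] := leqP 4 N.
    by rewrite natrB // => /andP[h1 h2]; apply/andP; split; lra.
  rewrite (_ : (N - 4 = 0)%N); last by lia.
  rewrite tail_count_le7 //= => _.
  have : (N%:R : R) <= 4 by rewrite (ler_nat _ N 4) ltnW.
  by have N0 : 0 <= N%:R :> R by []; move=> ?; apply/andP; split; nra.
apply/cvgrPdist_le => e e_gt0; near=> N.
have N_gt0 : 0 < N%:R :> R by rewrite ltr0n; near: N; exists 1%N.
have -> : delta - (multiple_count N)%:R / N%:R =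
   - (((multiple_count N)%:R - delta * N%:R) / N%:R).
  by field; rewrite gt_eqF.
rewrite normrN normrM normfV (gtr0_norm N_gt0) ler_pdivrMr //.
apply: le_trans (bound N) _.
rewrite mulrC -ler_pdivrMr //; near: N; exact: nbhs_infty_ger.
Unshelve. all: by end_near.
Qed.
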